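(* Let $K$ be a formally real field and $X$ a subset of the affine space $K^n$. Then $\mathcal{M}_X=\{M_P\mid P\in X\}$ has the P.A-property for $R=K[x_1,\ldots,x_n]$.
   Context: For a point $P\in K^n$, $M_P=\{f\in K[x_1,\ldots,x_n]\mid f(P)=0\}$, a maximal ideal of the polynomial ring. A set $\mathcal{A}\subseteq \mathrm{Spec}(R)$ of prime ideals of a commutative ring $R$ has the P.A-property (prime avoidance property) for $R$ if whenever an ideal $I$ of $R$ satisfies $I\subseteq\bigcup_{Q\in\mathcal{A}}Q$, there exists $Q\in\mathcal{A}$ with $I\subseteq Q$. *)

(* Defs.v *)
From mathcomp Require Import all_boot all_order all_algebra.
From mathcomp Require Import boolp classical_sets.
From mathcomp Require Import mpoly.

Set Implicit Arguments.
Unset Strict Implicit.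
Unset Printing Implicit Defensive.

Import GRing.Theory.
Local Open Scope ring_scope.
Local Open Scope classical_set_scope.

Definition formally_real (K : fieldType) : Prop :=
  ~ exists s : seq K, -1 = \sum_(x <- s) x ^+ 2.

(* The improper ideal is allowed, contrary to [idealr_closed] in
   [ring_quotient], and membership is not required to be decidable. *)
Definition is_ideal (R : comPzRingType) (I : set R) : Prop :=
  [/\ I 0,
      forall x y, I x -> I y -> I (x + y)
    & forall a x, I x -> I (a * x)].

Definition is_prime_ideal (R : comPzRingType) (Q : set R) : Prop :=
  [/\ is_ideal Q,
      ~ Q 1
    & forall x y, Q (x * y) -> Q x \/ Q y].

Definition Spec (R : comPzRingType) : set (set R) :=
  [set Q | is_prime_ideal Q].
Arguments Spec R : clear implicits.

Definition PA_property (R : comPzRingType) (A : set (set R)) : Prop :=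
  A `<=` Spec R /\
  forall I : set R, is_ideal I ->
    I `<=` \bigcup_(Q in A) Q -> exists2 Q, A Q & I `<=` Q.

Definition point_ideal (K : fieldType) (n : nat) (P : 'rV[K]_n) :
    set {mpoly K[n]} :=
  [set f | f.@[fun i => P ord0 i] = 0].

Definition point_ideals (K : fieldType) (n : nat) (X : set 'rV[K]_n) :
    set (set {mpoly K[n]}) :=
  [set point_ideal P | P in X].

(* Main.v *)
From HB Require Import structures.
Require Import Defs.
From mathcomp Require Import all_boot all_order all_algebra.
From mathcomp Require Import boolp classical_sets.
From mathcomp Require Import mpoly.

(** Every ideal [I] of K[x_1, ..., x_n] is generated by finitely many
polynomials f_1, ..., f_r (Hilbert's basis theorem). If [I] lies in the union
of the point ideals of [X], then so does its element f_1^2 + ... + f_r^2, which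
therefore vanishes at some [P] in [X]. Over a formally real field a sum of
squares is zero only if each term is ([sum_squares_eq0]), so every f_i vanishes
at [P], whence [I] is contained in the ideal of [P]. In other words, the sum of
squares turns the common zeros of finitely many polynomials into the zeros of a
single member of [I].

The basis theorem is proved in the classical way ([noetherian_poly]): an ideal
of R[X] is controlled by the ideals of [R] formed by the leading coefficients
of its members of each degree, an ascending chain that stops growing when [R]
is noetherian. It passes to K[x_1, ..., x_n] by induction on [n], because
K[x_1, ..., x_n+1] is a quotient of K[x_1, ..., x_n][X]. *)

Set Implicit Arguments.
Unset Strict Implicit.
Unset Printing Implicit Defensive.

Import GRing.Theory.
Local Open Scope ring_scope.
Local Open Scope classical_set_scope.

(** * Ideals and finite generation *)

Lemma is_idealB (R : comPzRingType) (I : set R) x y :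
  is_ideal I -> I x -> I y -> I (x - y).
Proof. by move=> [_ ID IM] Ix Iy; apply: ID => //; rewrite -mulN1r; apply: IM. Qed.

Lemma is_ideal_sum (R : comPzRingType) (I : set R) (s : seq R) (F : R -> R) :
  is_ideal I -> (forall x, x \in s -> I (F x)) -> I (\sum_(x <- s) F x).
Proof.
by move=> [I0 ID _] IF; rewrite big_seq; elim/big_ind: _.
Qed.

Lemma is_idealI (R : comPzRingType) (I J : set R) :
  is_ideal I -> is_ideal J -> is_ideal (I `&` J).
Proof.
move=> [I0 ID IM] [J0 JD JM]; split=> //.
- by move=> x y [Ix Jx] [Iy Jy]; split; [apply: ID | apply: JD].
- by move=> a x [Ix Jx]; split; [apply: IM | apply: JM].
Qed.

Lemma is_ideal_preimage (R S : comPzRingType) (f : {rmorphism R -> S})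
    (I : set S) :
  is_ideal I -> is_ideal (f @^-1` I).
Proof.
move=> [I0 ID IM]; split=> /=; first by rewrite rmorph0.
- by move=> x y Ix Iy; rewrite rmorphD; apply: ID.
- by move=> a x Ix; rewrite rmorphM; apply: IM.
Qed.

(** That [I] is the smallest ideal containing [s] is said through the ideals
[J] above [s], rather than through linear combinations, since every use below
is of the form: [J] contains [s], hence contains [I]. *)
Definition generates (R : comPzRingType) (s : seq R) (I : set R) : Prop :=
  [set` s] `<=` I /\ forall J, is_ideal J -> [set` s] `<=` J -> I `<=` J.

Definition noetherian (R : comPzRingType) : Prop :=
  forall I : set R, is_ideal I -> exists s, generates s I.

Lemma noetherian_field (K : fieldType) : noetherian K.
Proof.
move=> I [I0 ID IM].
have [[x Ix x_neq0]|Ieq0] := pselect (exists2 x, I x & x != 0).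
  exists [:: x]; split=> [y /=|J [_ _ JM] sJ y _].
    by rewrite inE => /eqP ->.
  by rewrite -[y](divfK x_neq0); apply/JM/sJ; rewrite /= inE.
exists [::]; split=> [|J [J0 _ _] _ y Iy]; first by move=> y.
by have [->//|y_neq0] := eqVneq y 0; case: Ieq0; exists y.
Qed.

Lemma noetherian_quotient (R S : comPzRingType) (f : {rmorphism R -> S}) :
  (forall y, exists x, f x = y) -> noetherian R -> noetherian S.
Proof.
move=> f_surj noethR I idI.
have [s [sI genI]] := noethR _ (is_ideal_preimage f idI).
exists (map f s); split=> [_ /= /mapP[x xs ->]|J idJ sJ y Iy]; first exact: sI.
have [x fx] := f_surj y; rewrite -fx.
apply: (genI (f @^-1` J)); first exact: is_ideal_preimage.
  by move=> z zs; apply: sJ; apply: map_f.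
by rewrite /= fx.
Qed.

(** * Hilbert's basis theorem *)

Lemma seq_witnesses (T U : eqType) (A : set U) (Q : T -> U -> Prop)
    (s : seq T) :
  (forall x, x \in s -> exists2 y, A y & Q x y) ->
  exists2 t : seq U, [set` t] `<=` A &
    forall x, x \in s -> exists2 y, y \in t & Q x y.
Proof.
elim: s => [_|a s IHs sQ]; first by exists [::].
have [y Ay Qay] := sQ a (mem_head _ _).
have [|t tA tQ] := IHs; first by move=> x xs; apply: sQ; rewrite inE xs orbT.
exists (y :: t) => [z /=|x]; rewrite inE => /predU1P[->//|].
- exact: tA.
- by exists y; rewrite ?mem_head.
- by move/tQ=> [z zt Qxz]; exists z; rewrite // inE zt orbT.
Qed.

(** Members of degree less than [d] contribute the coefficient zero, which is
what makes this set an ideal. *)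
Definition lead_coefs (R : comNzRingType) (I : set {poly R}) (d : nat) :
    set R :=
  [set p`_d | p in [set p | I p /\ (size p <= d.+1)%N]].

Lemma is_ideal_lead_coefs (R : comNzRingType) (I : set {poly R}) d :
  is_ideal I -> is_ideal (lead_coefs I d).
Proof.
move=> [I0 ID IM]; split.
- by exists 0; rewrite ?coef0 //=; rewrite size_poly0.
- move=> _ _ [p [Ip szp] <-] [q [Iq szq] <-]; exists (p + q); rewrite ?coefD //.
  split; first exact: ID.
  by rewrite (leq_trans (size_polyD p q)) // geq_max szp szq.
- move=> a _ [p [Ip szp] <-]; exists (a%:P * p); rewrite ?coefCM //.
  split; first exact: IM.
  by rewrite mul_polyC (leq_trans (size_scale_leq a p)).
Qed.

Lemma lead_coefs_homo (R : comNzRingType) (I : set {poly R}) d e :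
  is_ideal I -> (d <= e)%N -> lead_coefs I d `<=` lead_coefs I e.
Proof.
move=> [_ _ IM] le_de _ [p [Ip szp] <-]; exists ('X^(e - d) * p).
  split; first exact: IM.
  apply/leq_sizeP => j le_ej; rewrite coefXnM; case: ltnP => // _.
  move/leq_sizeP: szp; apply; rewrite ltn_subRL.
  by rewrite addnC subnKC.
by rewrite coefXnM ltnNge leq_subr subKn.
Qed.

(** Subtracting from a member of [I] a member of [J] with the same leading term
lowers its degree. *)
Lemma sub_ideal_lead_coefs (R : comNzRingType) (I J : set {poly R}) :
  is_ideal I -> is_ideal J -> J `<=` I ->
  (forall d, lead_coefs I d `<=` lead_coefs J d) -> I `<=` J.
Proof.
move=> idI [J0 JD _] JI leadIJ p; have [k] := ubnPeq (size p).
move/eqP/eq_leq; elim: k p => [|k IHk] p.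
  by move/size_poly_leq0P ->.
move=> szp Ip; have [q [Jq szq] eq_qp] : lead_coefs J k p`_k.
  by apply: leadIJ; exists p.
rewrite -(subrK q p); apply: JD => //.
apply: IHk; last by apply: is_idealB => //; apply: JI.
apply/leq_sizeP => j; rewrite leq_eqVlt coefB => /predU1P[<-|lt_kj].
  by rewrite eq_qp subrr.
by move/leq_sizeP: szp => ->//; move/leq_sizeP: szq => ->//; rewrite subrr.
Qed.

(** Choosing, in [I], one polynomial above each generator of the ideal of
leading coefficients in degree [d]. *)
Lemma lead_coefs_witnesses (R : comNzRingType) (I : set {poly R}) d :
  noetherian R -> is_ideal I ->
  exists2 t : seq {poly R}, [set` t] `<=` I &
    forall J, is_ideal J -> [set` t] `<=` J ->
      lead_coefs I d `<=` lead_coefs J d.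
Proof.
move=> noethR idI; have [s [sI genI]] := noethR _ (is_ideal_lead_coefs d idI).
have [|t tI ts] := @seq_witnesses _ _ I
  (fun c p => (size p <= d.+1)%N /\ p`_d = c) s.
  by move=> c /sI [p [Ip szp] pd]; exists p.
exists t => // J idJ tJ; apply: genI; first exact: is_ideal_lead_coefs.
by move=> c /ts [p pt [szp pd]]; exists p => //; split=> //; apply: tJ.
Qed.

Lemma lead_coefs_stationary (R : comNzRingType) (I : set {poly R}) :
  noetherian R -> is_ideal I ->
  exists N, forall d, lead_coefs I d `<=` lead_coefs I N.
Proof.
move=> noethR idI.
have idL : is_ideal (\bigcup_d lead_coefs I d).
  split.
  - by exists 0%N => //; case: (is_ideal_lead_coefs 0 idI).
  - move=> x y [d _ dx] [e _ ey]; exists (maxn d e) => //.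
    have [_ LD _] := is_ideal_lead_coefs (maxn d e) idI.
    by apply: LD; [move: dx | move: ey]; apply: lead_coefs_homo;
      rewrite // ?leq_maxl ?leq_maxr.
  - move=> a x [d _ dx]; exists d => //.
    by have [_ _ LM] := is_ideal_lead_coefs d idI; apply: LM.
have [s [sL genL]] := noethR _ idL.
have [|t _ ts] := @seq_witnesses _ _ setT (fun c d => lead_coefs I d c) s.
  by move=> c /sL[d]; exists d.
exists (\max_(d <- t) d)%N => d c dc.
apply: genL; [exact: is_ideal_lead_coefs | | by exists d].
move=> b /ts[e et]; apply: lead_coefs_homo => //.
exact: (@leq_bigmax_seq _ _ xpredT id e et).
Qed.

(** Beyond the degree [N] where the chain is stationary no new generator is
needed, so the witnesses in degrees at most [N] generate [I]. *)
Lemma noetherian_poly (R : comNzRingType) :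
  noetherian R -> noetherian {poly R}.
Proof.
move=> noethR I idI; have [N leadN] := lead_coefs_stationary noethR idI.
have [|ts tsI tsP] := @seq_witnesses _ _
  (fun t : seq {poly R} => [set` t] `<=` I)
  (fun d t => forall J, is_ideal J -> [set` t] `<=` J ->
      lead_coefs I d `<=` lead_coefs J d) (iota 0 N.+1).
  by move=> d _; apply: lead_coefs_witnesses.
have sI : [set` flatten ts] `<=` I by move=> p /flattenP[t /tsI]; apply.
exists (flatten ts); split=> // J idJ sJ.
have idIJ := is_idealI idI idJ.
suff : I `<=` I `&` J by move=> IIJ p /IIJ[].
have leadIJ d : (d <= N)%N -> lead_coefs I d `<=` lead_coefs (I `&` J) d.
  move=> le_dN; have [|t t_ts] := tsP d; first by rewrite mem_iota.
  apply=> // p pt; have p_ts : p \in flatten ts by apply/flattenP; exists t.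
  by split; [apply: sI | apply: sJ].
apply: sub_ideal_lead_coefs => // d.
have [/leadIJ//|lt_Nd] := leqP d N.
move=> c /leadN /(leadIJ _ (leqnn N)).
exact: lead_coefs_homo (ltnW lt_Nd) _.
Qed.

Section AdjoinLastVariable.
Variables (K : fieldType) (n : nat).

Let last_var_comm : commr_rmorph (@mwiden n K) 'X_ord_max.
Proof. by move=> p; apply: mulrC. Qed.

Definition poly_to_mpoly := horner_morph last_var_comm.

HB.instance Definition _ := GRing.RMorphism.on poly_to_mpoly.

Lemma poly_to_mpoly_surj (q : {mpoly K[n.+1]}) :
  exists p, poly_to_mpoly p = q.
Proof.
have surjX i : exists p, poly_to_mpoly p = 'X_i.
  have [j ->|->] := unliftP ord_max i; last first.
    by exists 'X; apply: horner_morphX.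
  exists ('X_j)%:P; rewrite /poly_to_mpoly horner_morphC /= mwidenX mnmwiden1.
  by congr 'X_[ U_(_) ]; apply: val_inj; rewrite /= /bump leqNgt ltn_ord.
elim/mpolyind: q => [|c m q _ _ [p <-]]; first by exists 0; rewrite rmorph0.
have [p' eqp'] : exists p', poly_to_mpoly p' = 'X_[m].
  rewrite mpolyXE_id; elim/big_ind: _ => [|_ _ [p1 <-] [p2 <-]|i _].
  - by exists 1; rewrite rmorph1.
  - by exists (p1 * p2); rewrite rmorphM.
  - by have [p1 <-] := surjX i; exists (p1 ^+ m i); rewrite rmorphXn.
exists ((c%:MP)%:P * p' + p); rewrite rmorphD rmorphM /= eqp'.
by rewrite /poly_to_mpoly horner_morphC /= mwidenC mul_mpolyC.
Qed.

End AdjoinLastVariable.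

Lemma noetherian_mpoly (K : fieldType) n : noetherian {mpoly K[n]}.
Proof.
elim: n => [|n IHn]; last first.
  by apply: noetherian_quotient (@poly_to_mpoly_surj K n) (noetherian_poly IHn).
apply: (@noetherian_quotient K _ (@mpolyC 0 K)) (@noetherian_field K) => q.
exists q@_0; rewrite [RHS]mpolyE.
apply/mpolyP => m.
have -> : m = 0%MM by apply/mnmP; case.
by rewrite -mpolyE mcoeffC eqxx mulr1.
Qed.

(** * Point ideals over formally real fields *)

(** If [x] were a nonzero term, then dividing the vanishing sum by [x ^+ 2]
would exhibit -1 as a sum of squares. *)
Lemma sum_squares_eq0 (K : fieldType) (s : seq K) :
  formally_real K -> \sum_(x <- s) x ^+ 2 = 0 -> forall x, x \in s -> x = 0.
Proof.
move=> realK s0 x xs; apply/eqP/negPn/negP => x_neq0; apply: realK.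
exists [seq y / x | y <- rem x s]; rewrite big_map.
under eq_bigr do rewrite expr_div_n.
move: s0; rewrite -mulr_suml (perm_big _ (perm_to_rem xs)) big_cons /= addrC.
by move/eqP; rewrite addr_eq0 => /eqP ->; rewrite mulNr divff // expf_neq0.
Qed.

Lemma point_ideal_Spec (K : fieldType) n (P : 'rV[K]_n) :
  Spec {mpoly K[n]} (point_ideal P).
Proof.
rewrite /Spec /point_ideal; split=> [||f g] /=.
- split=> [|f g|a f] /=; first by rewrite meval0.
  + by rewrite mevalD => -> ->; rewrite addr0.
  + by rewrite mevalM => ->; rewrite mulr0.
- by rewrite meval1; apply/eqP/oner_neq0.
- by rewrite mevalM => /eqP; rewrite mulf_eq0 => /orP[] /eqP; [left | right].
Qed.

Theorem corollary2p19 (K : fieldType) (n : nat) (X : set 'rV[K]_n) :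
  formally_real K -> PA_property (point_ideals X).
Proof.
move=> realK; split=> [_ [P _ <-]|I idI I_sub]; first exact: point_ideal_Spec.
have [s [sI genI]] := noetherian_mpoly idI.
have [_ [P XP <-]] : (\bigcup_(Q in point_ideals X) Q) (\sum_(f <- s) f ^+ 2).
  apply: I_sub; apply: is_ideal_sum => // f /sI If.
  by have [_ _ IM] := idI; apply: IM.
rewrite /point_ideal /= rmorph_sum /= => sumP0.
exists (point_ideal P); first by exists P.
apply: genI; first by case: (point_ideal_Spec P).
move=> f fs; apply: (@sum_squares_eq0 K [seq f.@[P ord0] | f <- s]) => //.
  by rewrite big_map -[RHS]sumP0; apply: eq_bigr => g _; rewrite rmorphXn.
exact: map_f fs.
Qed.
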